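(* Let $P$ be an ideal right-angled polyhedron in three-dimensional Lobachevsky (hyperbolic) space $\mathbb{H}^3$ having $N$ faces, and let $p_3$ be the number of its triangular faces. If $N < 3p_3 + 2$, then $P$ is not an ITR-polyhedron.
   Context: An ideal right-angled polyhedron in $\mathbb{H}^3$ is a convex finite-volume polyhedron all of whose vertices lie on the absolute (sphere at infinity) and all of whose dihedral angles equal $\pi/2$; in such a polyhedron every vertex is incident to exactly four edges. An ideal right-angled polyhedron is called an ITR-polyhedron (it satisfies the isolated triangles rule) if no two distinct triangular faces of it have a common vertex. *)

(* Defs.v *)
From HB Require Import structures.
From mathcomp Require Import all_boot all_order all_algebra.
From mathcomp Require Import all_classical all_reals all_analysis.
Import Order.TTheory GRing.Theory Num.Theory numFieldNormedType.Exports.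

Set Implicit Arguments.
Unset Strict Implicit.
Unset Printing Implicit Defensive.

Local Open Scope classical_set_scope.
Local Open Scope ring_scope.

(* Lobachevsky space H^3 in the Klein (projective) model: H^3 is the open unit
   ball of R^3, the absolute is the unit sphere, and hyperbolic planes are the
   nonempty intersections of affine planes with the ball.  The library norm on
   row vectors is the sup norm, hence an explicit Euclidean product. *)
Definition dotp (R : realType) (u v : 'rV[R]_3) : R :=
  \sum_(k < 3) u ord0 k * v ord0 k.

Definition H3 (R : realType) : set 'rV[R]_3 := [set x | dotp x x < 1].

Definition absolute (R : realType) : set 'rV[R]_3 := [set x | dotp x x = 1].

(* The pair (a, c) encodes the half-space { a.x <= c }.  Writing a point x of
   H^3 homogeneously as (x, 1), (a, c) is the outward normal vector for the
   Lorentz product below. *)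
Definition halfspace (R : realType) (e : 'rV[R]_3 * R) : set 'rV[R]_3 :=
  [set x | H3 x /\ dotp e.1 x <= e.2].

Definition bounding_plane (R : realType) (e : 'rV[R]_3 * R) : set 'rV[R]_3 :=
  [set x | H3 x /\ dotp e.1 x = e.2].

Definition lorentz (R : realType) (e f : 'rV[R]_3 * R) : R :=
  dotp e.1 f.1 - e.2 * f.2.

(* A convex polyhedron: a finite intersection of half-spaces with nonempty
   interior.  No half-space contains the intersection of the others, so the
   bounding planes are those of the faces and N is the number of faces. *)
Record polyhedron (R : realType) (N : nat) := Polyhedron {
  normal : 'I_N -> 'rV[R]_3 * R;
  (* spacelike normal: { a.x = c } meets the open unit ball *)
  _ : forall i, 0 < lorentz (normal i) (normal i);
  _ : (interior [set x | H3 x /\ forall i, halfspace (normal i) x]) !=set0;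
  _ : forall i, ~ ([set x | H3 x /\ forall j, j != i -> halfspace (normal j) x]
                     `<=` halfspace (normal i))
}.

Section Polyhedron.
Variables (R : realType) (N : nat) (P : polyhedron R N).

Definition body : set 'rV[R]_3 :=
  [set x | H3 x /\ forall i, halfspace (normal P i) x].

Definition face (i : 'I_N) : set 'rV[R]_3 :=
  body `&` bounding_plane (normal P i).

(* Vertices are the extreme points of the closure of P in the closed ball, so
   that proper and ideal vertices are treated alike; for P of finite volume
   this closure is a polytope.  (For P of infinite volume every point at
   infinity of P would qualify, but vertices are only used together with
   finite volume.) *)
Definition vertex (v : 'rV[R]_3) : Prop :=
  closure body v /\
  forall x y (t : R), closure body x -> closure body y -> 0 < t < 1 ->
    v = t *: x + (1 - t) *: y -> x = y.

Definition face_vertices (i : 'I_N) : set 'rV[R]_3 :=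
  [set v | vertex v /\ closure (face i) v].

Definition triangular (i : 'I_N) : Prop := (face_vertices i #= `I_3)%card.

Definition p3 : nat := #|[set i : 'I_N | `[< triangular i >]]%SET|.

(* Two faces share an edge: their planes being distinct, the common part lies
   on a line, and two distinct points make it one-dimensional. *)
Definition adjacent (i j : 'I_N) : Prop :=
  i <> j /\ exists x y, [/\ x <> y, (face i `&` face j) x
                                  & (face i `&` face j) y].

Definition dihedral_angle (i j : 'I_N) : R :=
  let e := normal P i in let f := normal P j in
  acos (- lorentz e f / (Num.sqrt (lorentz e e) * Num.sqrt (lorentz f f))).

End Polyhedron.

(* The Riemannian volume form of the Klein model of H^n (curvature -1) is
   (1 - |x|^2)^(-(n+1)/2) dx. *)
Definition point3 (R : realType) (x : R * R * R) : 'rV[R]_3 :=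
  \row_(k < 3) nth 0 [:: x.1.1; x.1.2; x.2] k.

Definition hvolume (R : realType) (A : set 'rV[R]_3) : \bar R :=
  (\int[(@lebesgue_measure R \x @lebesgue_measure R) \x @lebesgue_measure R]_(x
     in @point3 R @^-1` A)
     ((1 - dotp (point3 x) (point3 x)) ^- 2)%:E)%E.

Definition ideal_right_angled (R : realType) (N : nat) (P : polyhedron R N) :
    Prop :=
  [/\ (hvolume (body P) < +oo)%E,
      vertex P `<=` @absolute R
    & forall i j, adjacent P i j -> dihedral_angle P i j = pi / 2].

Definition ITR_polyhedron (R : realType) (N : nat) (P : polyhedron R N) :
    Prop :=
  ideal_right_angled P /\
  forall i j, i <> j -> triangular P i -> triangular P j ->
    ~ exists v, face_vertices P i v /\ face_vertices P j v.

(* Main.v *)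
(* At an ideal vertex the dihedral angles force the link of the polyhedron in a
   horosphere to be a Euclidean rectangle, so four faces meet there, along four
   rays.  For a generic linear functional the signs along these rays cannot
   alternate, because the diagonals of the rectangle have the same midpoint;
   hence every vertex is the highest or the lowest point of at least two of its
   faces, and of four for the top and bottom vertices.  A face has one highest
   and one lowest point, so 2 N >= 2 (V - 2) + 8, that is N >= V + 2 (half of
   Euler's formula).  If the triangles are isolated, V >= 3 p_3.  Finite volume
   is used to see that the half-spaces intersect inside the closed ball. *)
Require Import Defs.
From HB Require Import structures.
From mathcomp Require Import all_boot all_order all_algebra.
From mathcomp Require Import all_classical all_reals all_analysis.
From mathcomp Require Import measurable_realfun zify ring lra.
Import Order.TTheory GRing.Theory Num.Theory numFieldNormedType.Exports.

Set Implicit Arguments.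
Unset Strict Implicit.
Unset Printing Implicit Defensive.

Local Open Scope classical_set_scope.
Local Open Scope ring_scope.

(** * Euclidean geometry of R^3 *)

Section DotProduct.
Variable R : realType.
Implicit Types (u v w d b e : 'rV[R]_3) (t : R).

Lemma dotpE u v : dotp u v = u ord0 0 * v ord0 0 + u ord0 1 * v ord0 1
                           + u ord0 2%:R * v ord0 2%:R.
Proof.
rewrite /dotp !big_ord_recl big_ord0 addr0 -addrA.
by congr (_ + (_ + _)); congr (u _ _ * v _ _); apply/val_inj.
Qed.

Lemma dotpC u v : dotp u v = dotp v u.
Proof. by rewrite !dotpE; ring. Qed.

Lemma dotpDr u v w : dotp u (v + w) = dotp u v + dotp u w.
Proof. by rewrite !dotpE !mxE; ring. Qed.

Lemma dotpZr u t v : dotp u (t *: v) = t * dotp u v.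
Proof. by rewrite !dotpE !mxE; ring. Qed.

Lemma dotpNr u v : dotp u (- v) = - dotp u v.
Proof. by rewrite !dotpE !mxE; ring. Qed.

Lemma dotpDl u v w : dotp (v + w) u = dotp v u + dotp w u.
Proof. by rewrite !(dotpC _ u) dotpDr. Qed.

Lemma dotpZl u t v : dotp (t *: v) u = t * dotp v u.
Proof. by rewrite !(dotpC _ u) dotpZr. Qed.

Lemma dotpNl u v : dotp (- v) u = - dotp v u.
Proof. by rewrite !(dotpC _ u) dotpNr. Qed.

Lemma dotp0r u : dotp u 0 = 0.
Proof. by rewrite -(scale0r 0) dotpZr mul0r. Qed.

Definition dotpLin := (dotpDr, dotpDl, dotpNr, dotpNl, dotpZr, dotpZl).

Lemma dotp_ge0 u : 0 <= dotp u u.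
Proof. by rewrite dotpE !addr_ge0 // -expr2 sqr_ge0. Qed.

Lemma dotp_eq0 u : dotp u u = 0 -> u = 0.
Proof.
rewrite dotpE => /eqP.
rewrite !paddr_eq0 ?addr_ge0 -?expr2 ?sqr_ge0 // !sqrf_eq0.
move=> /andP[/andP[/eqP u0 /eqP u1] /eqP u2].
apply/rowP => k; rewrite mxE.
have [->|->|->] : [\/ k = 0, k = 1 | k = 2%:R].
  case: k => -[|[|[|//]]] ?; [constructor 1|constructor 2|constructor 3];
  exact: val_inj.
all: by [].
Qed.

Lemma dotp_gt0 u : u != 0 -> 0 < dotp u u.
Proof.
by move=> u0; rewrite lt_def dotp_ge0 andbT; apply: contra u0 => /eqP/dotp_eq0->.
Qed.

Definition cross u v : 'rV[R]_3 := \row_k nth 0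
  [:: u ord0 1 * v ord0 2%:R - u ord0 2%:R * v ord0 1;
      u ord0 2%:R * v ord0 0 - u ord0 0 * v ord0 2%:R;
      u ord0 0 * v ord0 1 - u ord0 1 * v ord0 0] k.

Lemma dotp_cross u v w : dotp (cross u v) w =
  (u ord0 1 * v ord0 2%:R - u ord0 2%:R * v ord0 1) * w ord0 0 +
  (u ord0 2%:R * v ord0 0 - u ord0 0 * v ord0 2%:R) * w ord0 1 +
  (u ord0 0 * v ord0 1 - u ord0 1 * v ord0 0) * w ord0 2%:R.
Proof. by rewrite dotpE !mxE. Qed.

Lemma dotp_crossl u v : dotp (cross u v) u = 0.
Proof. by rewrite dotp_cross; ring. Qed.

Lemma dotp_crossr u v : dotp (cross u v) v = 0.
Proof. by rewrite dotp_cross; ring. Qed.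

Lemma dotp_cross_sqr u v : dotp (cross u v) (cross u v) =
  dotp u u * dotp v v - dotp u v ^+ 2.
Proof. by rewrite dotp_cross !mxE !dotpE /=; ring. Qed.

(* The Gram determinant of [u, v, d] against [u, v, e]. *)
Lemma dotp_cross_mul u v d e : dotp d u = 0 -> dotp d v = 0 ->
  dotp (cross u v) d * dotp (cross u v) e =
  (dotp u u * dotp v v - dotp u v ^+ 2) * dotp d e.
Proof.
move=> du dv.
suff -> : dotp (cross u v) d * dotp (cross u v) e =
    (dotp u u * dotp v v - dotp u v ^+ 2) * dotp d e
    + dotp d u * (dotp u v * dotp v e - dotp v v * dotp u e)
    + dotp d v * (dotp u v * dotp u e - dotp u u * dotp v e).
  by rewrite du dv; ring.
by rewrite !dotp_cross !dotpE; ring.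
Qed.

(** Apply the Gram identity [dotp_cross_mul] to [d] and [e]: either [d] or [e] is orthogonal to
    [cross u v]. The same identity paired with itself then makes that vector zero, and [e] is
    not. *)
Lemma orthogonal_basis_eq0 u v e d : u != 0 -> v != 0 -> e != 0 ->
  dotp u v = 0 -> dotp e u = 0 -> dotp e v = 0 ->
  dotp d u = 0 -> dotp d v = 0 -> dotp d e = 0 -> d = 0.
Proof.
move=> /dotp_gt0 u0 /dotp_gt0 v0 /dotp_gt0 e0 uv eu ev du dv de.
have uv0 : 0 < dotp u u * dotp v v by rewrite mulr_gt0.
have := dotp_cross_mul e du dv; rewrite de mulr0 => /eqP; rewrite mulf_eq0.
case/orP => /eqP h.
  have := dotp_cross_mul d du dv; rewrite h mul0r uv expr0n subr0 => /esym/eqP.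
  by rewrite mulf_eq0 gt_eqF //= => /eqP/dotp_eq0.
have := dotp_cross_mul e eu ev; rewrite h mul0r uv expr0n subr0 => /esym/eqP.
by rewrite mulf_eq0 !gt_eqF.
Qed.

(** A vector orthogonal to [a] and [b] lies on the line of [cross a b], where [l] vanishes only at
    the origin. This is how a generic functional is seen not to vanish on edges. *)
Lemma cross_line_eq0 a b l r : cross a b != 0 ->
  dotp l (cross a b) != 0 -> dotp a r = 0 -> dotp b r = 0 -> dotp l r = 0 ->
  r = 0.
Proof.
set w := cross a b => /dotp_gt0 w0 lw ar br lr.
have := dotp_cross_mul l (etrans (dotpC r a) ar) (etrans (dotpC r b) br).
rewrite -/w -dotp_cross_sqr -/w (dotpC r) lr mulr0 => /eqP.
rewrite mulf_eq0 (dotpC w l) (negbTE lw) orbF => /eqP wr.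
have := dotp_cross_mul r (etrans (dotpC r a) ar) (etrans (dotpC r b) br).
rewrite -/w wr mul0r -dotp_cross_sqr -/w => /esym/eqP.
by rewrite mulf_eq0 gt_eqF //= => /eqP/dotp_eq0.
Qed.

Lemma exists_orthogonal v : exists2 e, e != 0 & dotp e v = 0.
Proof.
have [v0|v0] := eqVneq (v ord0 0) 0.
  exists (delta_mx ord0 0); last by rewrite dotpE !mxE /= v0; ring.
  by apply/eqP => /rowP/(_ 0); rewrite !mxE /= => /eqP; rewrite oner_eq0.
exists (cross v (delta_mx ord0 1)); last exact: dotp_crossl.
apply/eqP => /rowP/(_ 2%:R); rewrite !mxE /= => /eqP.
by rewrite mulr1 mulr0 subr0 (negbTE v0).
Qed.

Lemma cross_neq0 u v : u != 0 -> v != 0 -> dotp u v = 0 -> cross u v != 0.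
Proof.
move=> /dotp_gt0 u0 /dotp_gt0 v0 uv; apply/eqP => h.
have := dotp_cross_sqr u v; rewrite h dotp0r uv expr0n subr0 => /esym/eqP.
by rewrite mulf_eq0 !gt_eqF.
Qed.

End DotProduct.

(** * The link of an ideal vertex *)

Section Cusp.
Variables (R : realType) (I : finType) (v : 'rV[R]_3) (A : pred I).
Variables (b : I -> 'rV[R]_3) (c : I -> R).

(* The section of the tangent cone at [v] by the horosphere [d.v = -1]. *)
Definition cusp_section (d : 'rV[R]_3) :=
  dotp d v = -1 /\ forall j, A j -> dotp (b j) d <= c j.

Record cusp_corner i j (r : 'rV[R]_3) : Prop := CuspCorner {
  _ : A i;
  _ : A j;
  _ : i != j;
  _ : cusp_section r;
  _ : dotp (b i) r = c i;
  _ : dotp (b j) r = c j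
}.

(** Side [i] of the link lies in the segment from [r] to [r'], so the two corners bound the face
    along the cusp. *)
Definition cusp_side i (r r' : 'rV[R]_3) :=
  forall d, cusp_section d -> dotp (b i) d = c i ->
    exists p q, [/\ 0 <= p, 0 <= q, p + q = 1 & d = p *: r + q *: r'].

(** For an ideal vertex these say that the link is a bounded polygon, that every active index gives
    a genuine side with a relative interior point ([facet]), and that sides meet at right angles. *)
Hypotheses (v0 : v != 0)
  (bv : forall i, A i -> dotp (b i) v = 0)
  (b0 : forall i, A i -> b i != 0)
  (facet : forall i, A i -> exists g, [/\ dotp g v = -1, dotp (b i) g = c i &
     forall j, A j -> j != i -> dotp (b j) g < c j])
  (bounded : forall e, e != 0 -> dotp e v = 0 ->
     exists2 j, A j & 0 < dotp (b j) e)
  (right_angle : forall i j r, cusp_corner i j r -> dotp (b i) (b j) = 0).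

(** Walk along side [i] from its interior point in direction [e]. Boundedness forces a first wall
    [j] to be hit, and the right angle there makes [b j] parallel to [e]. *)
Lemma cusp_walk i e : A i -> e != 0 -> dotp e v = 0 -> dotp e (b i) = 0 ->
  exists j r t, [/\ cusp_corner i j r, 0 < t & b j = t *: e].
Proof.
move=> Ai e0 ev ebi; have [g [gv gi gj]] := facet Ai.
have [j0 Aj0 bj0] := bounded e0 ev.
pose J := [pred j | A j && (0 < dotp (b j) e)].
(* [F j] is the time at which the walk reaches wall [j]; the wall with least time among those being
   approached is hit first. *)
pose F j := (c j - dotp (b j) g) / dotp (b j) e.
have Jj0 : J j0 by rewrite /= Aj0.
case: (@arg_minP _ _ _ j0 J F Jj0) => j /andP[/= Aj bje] minj.
have neq_ji k : 0 < dotp (b k) e -> k != i.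
  by apply: contraTneq => ->; rewrite dotpC ebi ltxx.
have F_ge0 : 0 <= F j.
  by rewrite divr_ge0 ?(ltW bje)// subr_ge0 ltW// gj// neq_ji.
pose r := g + F j *: e.
have jr : dotp (b j) r = c j.
  by rewrite /r !dotpLin /F divfK ?gt_eqF// subrKC.
have ir : dotp (b i) r = c i by rewrite /r !dotpLin (dotpC _ e) ebi mulr0 addr0.
have sr : cusp_section r.
  split; first by rewrite /r !dotpLin ev mulr0 addr0.
  move=> k Ak; have [->|ki] := eqVneq k i; first by rewrite ir.
  rewrite /r !dotpLin; have [ke|ke] := ltP 0 (dotp (b k) e).
    have := minj k; rewrite /= Ak ke => /(_ isT).
    by rewrite {2}/F ler_pdivlMr// lerBrDl.
  by rewrite (le_trans _ (ltW (gj _ Ak ki)))// gerDl mulr_ge0_le0.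
have corner : cusp_corner i j r by split; rewrite // eq_sym neq_ji.
have ee := dotp_gt0 e0.
(* The factor is that of the projection of [b j] to [e]; the remainder is orthogonal to [v], [b i]
   and [e]. *)
exists j, r, (dotp (b j) e / dotp e e); split=> //; first exact: divr_gt0.
apply/eqP; rewrite -subr_eq0; apply/eqP.
apply: (orthogonal_basis_eq0 v0 (b0 Ai) e0) => //.
- by rewrite dotpC bv.
- by rewrite !dotpLin bv// ev; ring.
- by rewrite !dotpLin (dotpC (b j)) (right_angle corner) ebi; ring.
- by rewrite !dotpLin divfK ?gt_eqF// subrr.
Qed.

(** Of two parallel walls with the same outward direction only the inner one can carry a side: the
    interior points of the two sides would give opposite strict inequalities. *)
Lemma cusp_normal_inj i j t : A i -> A j -> 0 < t -> b j = t *: b i -> i = j.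
Proof.
move=> Ai Aj t0 bji; apply/eqP/negPn/negP => neq.
have [g [_ gi gj]] := facet Ai; have [h [_ hj hi]] := facet Aj.
have := gj j Aj; rewrite eq_sym => /(_ neq); rewrite bji dotpZl gi => lt1.
have := hi i Ai neq; rewrite -(ltr_pM2l t0) -dotpZl -bji hj.
by rewrite ltNge (ltW lt1).
Qed.

(** The neighbours [j] and [k] of side [i] are opposite walls, so [dotp (b j)] is a coordinate along
    the side, bounded by its values at [r'] and [r]. *)
Lemma cusp_sideP i j k r r' t : cusp_corner i j r -> cusp_corner k i r' ->
  0 < t -> b k = - t *: b j -> cusp_side i r r'.
Proof.
move=> cij; case: (cij) => Ai Aj ij [rv sr] ir jr [Ak _ ki [rv' sr'] kr' ir'].
move=> t0 bkj d [dv sd] id.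
have jr' : dotp (b j) r' = - (c k / t).
  by rewrite -kr' bkj dotpLin; field; rewrite gt_eqF.
(* The interior point of side [i] lies strictly between the two walls, so the side is not
   degenerate. *)
have dlt : dotp (b j) r' < dotp (b j) r.
  have [g [_ gi gj]] := facet Ai; apply: (@lt_trans _ _ (dotp (b j) g)).
    rewrite jr' ltrNl ltr_pdivlMr//.
    by have := gj k Ak ki; rewrite bkj dotpLin mulNr mulrC mulNr.
  by rewrite jr gj// eq_sym.
have d1 : dotp (b j) d <= dotp (b j) r by rewrite jr sd.
have d2 : dotp (b j) r' <= dotp (b j) d.
  rewrite jr' lerNl ler_pdivlMr//.
  by have := sd k Ak; rewrite bkj dotpLin mulNr mulrC mulNr.
pose D := dotp (b j) r - dotp (b j) r'.
have D0 : 0 < D by rewrite subr_gt0.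
(* Barycentric coordinates of [d] read off from the coordinate [dotp (b j)]. *)
exists ((dotp (b j) d - dotp (b j) r') / D), ((dotp (b j) r - dotp (b j) d) / D).
have pq : (dotp (b j) d - dotp (b j) r') / D
        + (dotp (b j) r - dotp (b j) d) / D = 1.
  by rewrite -mulrDl addrC addrA subrK divff// gt_eqF.
split=> //.
- by apply: divr_ge0 (ltW D0); rewrite subr_ge0.
- by apply: divr_ge0 (ltW D0); rewrite subr_ge0.
set p := _ / D in pq *; set q := _ / D in pq *.
apply/eqP; rewrite -subr_eq0; apply/eqP.
apply: (orthogonal_basis_eq0 v0 (b0 Ai) (b0 Aj)).
- by rewrite dotpC bv.
- exact: bv.
- by rewrite dotpC (right_angle cij).
- by rewrite !dotpLin dv rv rv' !mulrN1 -opprD -opprD pq subrr oppr0.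
- rewrite !dotpLin !(dotpC _ (b i)) id ir ir' -mulrDl pq mul1r subrr //.
- rewrite !dotpLin !(dotpC _ (b j)) /p /q /D; field.
  by rewrite gt_eqF.
Qed.

(** From any side [i], walks in the two opposite directions reach its neighbours [j] and [k];
    turning towards [- b i] from either reaches the same opposite side [l]. *)
Theorem cusp_rectangle : exists i j l k r1 r2 r3 r4,
  [/\ uniq [:: i; j; l; k],
      [/\ cusp_corner i j r1, cusp_corner j l r2,
          cusp_corner l k r3 & cusp_corner k i r4],
      [/\ cusp_side i r1 r4, cusp_side j r2 r1,
          cusp_side l r3 r2 & cusp_side k r4 r3]
    & r1 + r3 = r2 + r4].
Proof.
have [e0 e00 e0v] := exists_orthogonal v; have [i Ai _] := bounded e00 e0v.
pose e := cross v (b i).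
have bi0 := b0 Ai.
have vbi : dotp v (b i) = 0 by rewrite dotpC bv.
have en0 : e != 0 by exact: cross_neq0.
have ev : dotp e v = 0 by exact: dotp_crossl.
have eb : dotp e (b i) = 0 by exact: dotp_crossr.
have corner_sym i1 i2 r : cusp_corner i1 i2 r -> cusp_corner i2 i1 r.
  by case=> ? ? ? ? ? ?; split; rewrite // eq_sym.
have [j [rj [t [cij t0 bj]]]] := cusp_walk Ai en0 ev eb.
have Aj : A j by case: cij.
have [k [rk [s [cik s0 bk]]]] : exists k r s,
    [/\ cusp_corner i k r, 0 < s & b k = s *: - e].
  by apply: cusp_walk; rewrite // ?oppr_eq0// dotpLin ?ev ?eb oppr0.
have Ak : A k by case: cik.
have [l [r2 [m [cjl m0 bl]]]] : exists l r m,
    [/\ cusp_corner j l r, 0 < m & b l = m *: - b i].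
  apply: cusp_walk; rewrite // ?oppr_eq0// dotpLin ?(bv Ai) ?oppr0//.
  by rewrite (right_angle cij) oppr0.
have Al : A l by case: cjl.
have [r1 c1] : exists r, cusp_corner i j r.
  have [i' [r [n [cji n0 bi']]]] := cusp_walk Aj bi0 (bv Ai) (right_angle cij).
  have Ai' : A i' by case: cji.
  by rewrite -(cusp_normal_inj Ai Ai' n0 bi') in cji; exists r; apply: corner_sym.
have [r4 c4] : exists r, cusp_corner k i r.
  have [i' [r [n [cki n0 bi']]]] := cusp_walk Ak bi0 (bv Ai) (right_angle cik).
  have Ai' : A i' by case: cki.
  by rewrite -(cusp_normal_inj Ai Ai' n0 bi') in cki; exists r.
have [r3 c3] : exists r, cusp_corner l k r.
  have [l' [r [n [ckl n0 bl']]]] : exists l' r m,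
    [/\ cusp_corner k l' r, 0 < m & b l' = m *: - b i].
    apply: cusp_walk; rewrite // ?oppr_eq0// dotpLin ?(bv Ai) ?oppr0//.
    by rewrite (right_angle cik) oppr0.
  have Al' : A l' by case: ckl.
  (* Both normals are positive multiples of [- b i], so the two walks end on one side. *)
  have ll' : l = l'.
    apply: (@cusp_normal_inj _ _ (n / m)) => //; first exact: divr_gt0.
    by rewrite bl scalerA divfK ?gt_eqF// -bl'.
  by rewrite -ll' in ckl; exists r; apply: corner_sym.
have bkj : b k = - (s / t) *: b j.
  by rewrite bj scalerA mulNr divfK ?gt_eqF// bk scalerN scaleNr.
have bli : b l = - m *: b i by rewrite bl scalerN scaleNr.
have bjk : b j = - (t / s) *: b k.
  by rewrite bk scalerA mulNr divfK ?gt_eqF// bj scalerN scaleNr opprK.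
have bil : b i = - m^-1 *: b l.
  by rewrite bl scalerA mulNr mulVf ?gt_eqF// scalerN scaleNr scale1r opprK.
have neqN i1 i2 n : A i1 -> 0 < n -> b i2 = - n *: b i1 -> i1 != i2.
  move=> A1 n0 b12; apply/eqP => eq12; have := dotp_gt0 (b0 A1).
  rewrite {2}eq12 b12 dotpLin => /lt_geF; rewrite leNgt => /negbFE.
  by rewrite nmulr_rgt0 ?oppr_lt0// ltNge dotp_ge0.
exists i, j, l, k, r1, r2, r3, r4; split=> //.
- rewrite /= !inE !negb_or !andbT.
  case: c1 c3 c4 (cjl) => _ _ -> _ _ _ [_ _ -> _ _ _] [_ _ ki _ _ _] [_ _ -> _ _ _].
  by rewrite (neqN _ _ m)// eq_sym ki (neqN _ _ (s / t))// divr_gt0.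
- split.
  + by apply: (cusp_sideP c1 c4 _ bkj); rewrite divr_gt0.
  + by apply: (cusp_sideP cjl c1 _ bil); rewrite invr_gt0.
  + by apply: (cusp_sideP c3 cjl _ bjk); rewrite divr_gt0.
  + exact: (cusp_sideP c4 c3 m0 bli).
case: (c1) (cjl) (c3) (c4) => _ _ _ [v1 _] i1 j1 [_ _ _ [v2 _] j2 l2].
move=> [_ _ _ [v3 _] l3 k3] [_ _ _ [v4 _] k4 i4].
(* The difference of the two sums is orthogonal to [v], [b i] and [b j]. Opposite sides are
   parallel, so [b i] is constant on side [l] and [b j] on side [k]. *)
apply/eqP; rewrite -subr_eq0; apply/eqP.
apply: (orthogonal_basis_eq0 v0 bi0 (b0 Aj)) => //.
- exact: bv.
- by rewrite dotpC (right_angle cij).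
- by rewrite !dotpLin v1 v2 v3 v4; ring.
- rewrite !dotpLin !(dotpC _ (b i)) i1 i4.
  suff -> : dotp (b i) r2 = dotp (b i) r3 by ring.
  by rewrite bil !dotpLin l2 l3.
- rewrite !dotpLin !(dotpC _ (b j)) j1 j2.
  suff -> : dotp (b j) r3 = dotp (b j) r4 by ring.
  by rewrite bjk !dotpLin k3 k4.
Qed.

End Cusp.

(** * Volume near the absolute *)

Section Slab.
Variable R : realType.
Implicit Types q x e : R.

Lemma sqr_le1 x : x ^+ 2 <= 1 -> `|x| <= 1.
Proof.
move=> x1; rewrite leNgt; apply/negP => ltx.
have : x ^+ 2 = `|x| ^+ 2 by rewrite real_normK// num_real.
by nra.
Qed.

Lemma sqr_dist_le q x e : q ^+ 2 <= 1 -> e <= 1 -> `|x - q| < e ->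
  `|x ^+ 2 - q ^+ 2| <= 3 * e.
Proof.
move=> /sqr_le1 q1 e1 xe; have := ltW xe.
rewrite subr_sqr normrM mulrC; move: (normr_ge0 (x - q)).
have : `|x + q| <= `|x - q| + 2 * `|q|.
  have -> : x + q = (x - q) + 2 * q by ring.
  by rewrite (le_trans (ler_normD _ _))// normrM ger0_norm.
move: (normr_ge0 (x + q)); nra.
Qed.

(** Near [q] the sphere is a graph over the first two coordinates. Just inside it, every vertical
    line carries a segment of length [d / 2] in the layer of depth [d], over a square whose size [e]
    does not depend on [d]. *)
Lemma sphere_slab q0 q1 q2 rho :
  q0 ^+ 2 + q1 ^+ 2 + q2 ^+ 2 = 1 -> q2 != 0 -> 0 < rho ->
  exists2 e, 0 < e <= rho & exists2 d0, 0 < d0 &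
  forall d, 0 < d <= d0 -> forall x0 x1, `|x0 - q0| < e -> `|x1 - q1| < e ->
  exists a, forall x2, a < x2 < a + d / 2 ->
    `|x2 - q2| < rho /\ 0 < 1 - (x0 ^+ 2 + x1 ^+ 2 + x2 ^+ 2) < d.
Proof.
move=> qq q2n0 rho0; set s := `|q2|.
have s0 : 0 < s by rewrite normr_gt0.
have ss : s ^+ 2 = q2 ^+ 2 by rewrite real_normK// num_real.
have [q0p q1p q2p] := And3 (sqr_ge0 q0) (sqr_ge0 q1) (sqr_ge0 q2).
have s1 : s <= 1 by apply: sqr_le1; lra.
(* Below, [m] differs from [s ^+ 2] by at most [6 * e]; the constants 24 make this at most
   [s ^+ 2 / 4] and [rho * s / 4]. *)
pose e := Num.min (Num.min 1 rho) (Num.min (rho * s / 24) (s ^+ 2 / 24)).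
have e0 : 0 < e.
  by rewrite !lt_min ltr01 rho0 !divr_gt0// ?mulr_gt0// exprn_gt0.
have e1 : e <= 1 by rewrite !ge_min lexx.
have erho : e <= rho by rewrite !ge_min lexx orbT.
have ers : e <= rho * s / 24 by rewrite !ge_min lexx !orbT.
have ess : e <= s ^+ 2 / 24 by rewrite !ge_min lexx !orbT.
exists e; first by rewrite e0.
exists (Num.min rho s); first by rewrite lt_min rho0.
move=> d /andP[d0]; rewrite le_min => /andP[drho ds] x0 x1.
move=> /sqr_dist_le-/(_ _ e1) hx0 /sqr_dist_le-/(_ _ e1) hx1.
have {hx0} := hx0 ltac:(lra); rewrite ler_norml => /andP[hx0 hx0'].
have {hx1} := hx1 ltac:(lra); rewrite ler_norml => /andP[hx1 hx1'].
pose m := 1 - (x0 ^+ 2 + x1 ^+ 2).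
have m1 : m <= 1 by rewrite /m; have := sqr_ge0 x0; have := sqr_ge0 x1; lra.
have msl : - (6 * e) <= m - s ^+ 2 by rewrite /m; lra.
have msu : m - s ^+ 2 <= 6 * e by rewrite /m; lra.
have m0 : 3 / 4 * s ^+ 2 <= m by lra.
(* [h] is the height of the sphere above [(x0, x1)]; it is within [rho / 4] of [s]. *)
pose h := Num.sqrt m.
have h0 : 0 <= h by exact: sqrtr_ge0.
have hh : h ^+ 2 = m by rewrite sqr_sqrtr//; have := sqr_ge0 s; lra.
have h1 : h <= 1 by rewrite -[h]ger0_norm//; apply: sqr_le1; rewrite hh.
have hs : s / 2 < h by rewrite ltNge; apply/negP => ?; nra.
have hsl : - (rho / 4) <= h - s.
  rewrite leNgt; apply/negP => lt1.
  have : (h - s) * (h + s) <= (h - s) * s by nra.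
  have : (h - s) * s < - (rho / 4) * s by rewrite ltr_pM2r.
  by rewrite -subr_sqr hh; lra.
have hsu : h - s <= rho / 4.
  rewrite leNgt; apply/negP => lt1.
  have : (h - s) * s <= (h - s) * (h + s) by nra.
  have : rho / 4 * s < (h - s) * s by rewrite ltr_pM2r.
  by rewrite -subr_sqr hh; lra.
have main y : h - d / 2 < y < h ->
    `|y - s| < rho /\ 0 < m - y ^+ 2 < d.
  move=> /andP[y1 y2]; split; first by rewrite ltr_norml; lra.
  (* [m - y ^+ 2] factors as [(h - y) * (h + y)]: the first factor is below [d / 2], the second
     below 2, and [y] is positive because [d <= s < 2 * h]. *)
  by rewrite -hh subr_sqr; apply/andP; split; nra.
have [q2p'|q2n] := ltP 0 q2.
  exists (h - d / 2) => x2 /andP[lo hi].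
  have -> : q2 = s by rewrite /s gtr0_norm.
  have [|A B] := main x2; first by apply/andP; split; lra.
  by split=> //; rewrite opprD addrA.
exists (- h) => x2 /andP[lo hi].
have [|A B] := main (- x2); first by lra.
split; first by rewrite distrC; move: A; rewrite /s (ler0_norm q2n) opprK addrC.
by rewrite opprD addrA -(sqrrN x2).
Qed.

End Slab.

(** * Measurability, and divergence of hyperbolic volume near a sphere point *)

Section Volume.
Variable R : realType.

Local Notation T3 := (measurableTypeR R * measurableTypeR R * measurableTypeR R)%type.

Local Notation leb := (@lebesgue_measure R).

Lemma dotp_point3 (u : 'rV[R]_3) (x : R * R * R) :
  dotp u (point3 x) = u ord0 0 * x.1.1 + u ord0 1 * x.1.2 + u ord0 2%:R * x.2.
Proof. by rewrite dotpE !mxE. Qed.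

Lemma dotp_point3_sqr (x : R * R * R) :
  dotp (point3 x) (point3 x) = x.1.1 ^+ 2 + x.1.2 ^+ 2 + x.2 ^+ 2.
Proof. by rewrite dotp_point3 !mxE. Qed.

Lemma measurable_dotp_point3 (u : 'rV[R]_3) :
  measurable_fun [set: T3] (fun x => dotp u (point3 x)).
Proof.
under eq_fun do rewrite dotp_point3.
apply: measurable_funD; first apply: measurable_funD.
all: by apply: measurable_funM => //; exact: measurableT_comp.
Qed.

Lemma measurable_dotp_point3_sqr :
  measurable_fun [set: T3] (fun x => dotp (point3 x) (point3 x)).
Proof.
under eq_fun do rewrite dotp_point3_sqr.
apply: measurable_funD; first apply: measurable_funD.
all: by apply: measurable_funX => //; exact: measurableT_comp.
Qed.

Lemma measurable_set_bool d (T : measurableType d) (f : T -> bool) :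
  measurable_fun [set: T] f -> measurable [set x | f x].
Proof.
by move=> /(_ measurableT [set true] I); rewrite setTI; congr (measurable _).
Qed.

Lemma measurable_point3_body N (P : polyhedron R N) :
  measurable (@point3 R @^-1` body P : set T3).
Proof.
have -> : @point3 R @^-1` body P = [set x | dotp (point3 x) (point3 x) < 1] `&`
    \bigcap_(i in [set: 'I_N])
      [set x | dotp (normal P i).1 (point3 x) <= (normal P i).2].
  apply/seteqP; split => x /=.
    by move=> [Hx Px]; split=> // i _; case: (Px i).
  by move=> [Hx Px]; split=> // i; split=> //; exact: Px.
apply: measurableI.
  apply: measurable_set_bool; apply: measurable_fun_ltr => //.
  exact: measurable_dotp_point3_sqr.
apply: fin_bigcap_measurable => [|i _]; first exact: finite_finset.
apply: measurable_set_bool; apply: measurable_fun_ler => //.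
exact: measurable_dotp_point3.
Qed.

Lemma measurable_hvolume_density (A : set T3) :
  A `<=` @point3 R @^-1` @H3 R ->
  measurable_fun A (fun x => (1 - dotp (point3 x) (point3 x)) ^- 2).
Proof.
move=> AH; pose g (x : T3) := 1 - dotp (point3 x) (point3 x).
have mg : measurable_fun [set: T3] g.
  by apply: measurable_funB => //; exact: measurable_dotp_point3_sqr.
apply: (@measurable_comp _ _ _ _ _ _ [set y : R | 0 < y] (fun y => y ^- 2) A g).
- by rewrite -set_itvoy.
- by move=> _ [x /AH Hx <-]; rewrite /= subr_gt0.
- apply: open_continuous_measurable_fun; first exact: open_gt.
  move=> y /set_mem/= y0.
  apply: (@continuousV _ _ (fun z : R => z ^+ 2)); last exact: exprn_continuous.
  by rewrite expf_neq0// gt_eqF.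
- exact: measurable_funTS.
Qed.

(* [hvolume A >= d^-2 * vol {x in A | 1 - |x|^2 < d} >= C / d]. *)
Lemma hvolume_cap_infty (A : set 'rV[R]_3) (q : 'rV[R]_3) (rho : R) :
  measurable (@point3 R @^-1` A : set T3) -> A `<=` @H3 R ->
  dotp q q = 1 -> q ord0 2%:R != 0 -> 0 < rho ->
  (forall x, H3 x -> (forall k, `|x ord0 k - q ord0 k| < rho) -> A x) ->
  hvolume A = +oo%E.
Proof.
move=> mA AH qq q2 rho0 qA.
have [e /andP[e0 erho] [d0 d00 slab]] : exists2 e, 0 < e <= rho & exists2 d0, 0 < d0 &
    forall d, 0 < d <= d0 -> forall x0 x1, `|x0 - q ord0 0| < e ->
    `|x1 - q ord0 1| < e -> exists a, forall x2, a < x2 < a + d / 2 ->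
    `|x2 - q ord0 2%:R| < rho /\ 0 < 1 - (x0 ^+ 2 + x1 ^+ 2 + x2 ^+ 2) < d.
  by apply: sphere_slab; rewrite // -qq dotpE.
pose D := @point3 R @^-1` A.
pose f (x : T3) := ((1 - dotp (point3 x) (point3 x)) ^- 2)%:E.
have mf : measurable_fun (D : set T3) f.
  by apply/measurable_EFinP; apply: measurable_hvolume_density => x /AH.
have f0 x : (0 <= f x)%E by rewrite lee_fin invr_ge0 exprn_even_ge0.
have bound d : 0 < d <= d0 -> ((2 * e ^+ 2 / d)%:E <= hvolume A)%E.
  move=> dd; have d_gt0 : 0 < d by case/andP: dd.
  have d2 : 0 < d ^- 2 by rewrite invr_gt0 exprn_gt0.
  (* Chebyshev's inequality at level [d ^- 2]: [S] is the part of [D] where the density reaches that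
     level. *)
  have := le_integral_abse (((leb \x leb) \x leb)%E) mA mf d2.
  under [X in (_ <= X)%E -> _]eq_integral do rewrite gee0_abs//.
  apply: le_trans; set S := _ `&` _.
  have mS : measurable (S : set T3).
    apply: measurable_lee => //; exact: measurableT_comp.
  pose I0 : set (measurableTypeR R) := [set x | `|x - q ord0 0| < e].
  pose I1 : set (measurableTypeR R) := [set x | `|x - q ord0 1| < e].
  have I0E : I0 = `]q ord0 0 - e, q ord0 0 + e[%classic.
    by apply/seteqP; split=> x; rewrite /I0 /= in_itv/= ltr_distl.
  have I1E : I1 = `]q ord0 1 - e, q ord0 1 + e[%classic.
    by apply/seteqP; split=> x; rewrite /I1 /= in_itv/= ltr_distl.
  have mI0 : measurable I0 by rewrite I0E.
  have mI1 : measurable I1 by rewrite I1E.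
  (* By Fubini: over the square of side [2 * e], each vertical section of [S] contains an interval
     of length [d / 2]. *)
  have S_ge : (((d / 2) * (2 * e) ^+ 2)%:E <=
     ((leb \x leb) \x leb)%E S)%E.
    have mI : measurable (I0 `*` I1) by exact: measurableX.
    rewrite /product_measure1 /=.
    pose sec x := leb (xsection S x).
    have msec : measurable_fun [set: measurableTypeR R * measurableTypeR R] sec.
      exact: measurable_fun_xsection.
    apply: (@le_trans _ _ (\int[leb \x leb]_(x in I0 `*` I1) sec x)%E); last first.
      by apply: ge0_subset_integral => //.
    apply: (@le_trans _ _ (\int[leb \x leb]_(x in I0 `*` I1) cst (d / 2)%:E x)%E).
      have lebI : (leb \x leb)%E (I0 `*` I1) = (leb I0 * leb I1)%E.
        exact: product_measure1E.
      have len (a : R) : leb `]a - e, a + e[%classic = (2 * e)%:E.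
        rewrite lebesgue_measure_itv /= lte_fin ifT; last lra.
        by rewrite -EFinB; congr EFin; ring.
      rewrite integral_cst// [X in (_ <= _ * X)%E]lebI I0E I1E !len.
      by rewrite -!EFinM lee_fin expr2.
    apply: ge0_le_integral => //.
    - by move=> x _; rewrite lee_fin divr_ge0// ltW.
    - exact: measurable_funTS.
    - move=> -[x0 x1] [/= xI0 xI1]; have [a slab_a] := slab d dd x0 x1 xI0 xI1.
      have <- : leb `]a, a + d / 2[%classic = (d / 2)%:E.
        rewrite lebesgue_measure_itv /= lte_fin ifT; last lra.
        by rewrite -EFinB; congr EFin; ring.
      apply: le_measure; rewrite ?inE//; first exact: measurable_xsection.
      move=> x2 /=; rewrite in_itv /= => /slab_a[x2q xd].
      rewrite /xsection /= inE.
      have xH : dotp (point3 (x0, x1, x2)) (point3 (x0, x1, x2)) < 1.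
        by rewrite dotp_point3_sqr/=; case/andP: xd; rewrite subr_gt0.
      split.
        apply: qA => // k; rewrite !mxE.
        case: k => -[|[|[|//]]] k3 /=.
        + by rewrite (lt_le_trans _ erho)// (_ : Ordinal k3 = 0)//; exact: val_inj.
        + by rewrite (lt_le_trans _ erho)// (_ : Ordinal k3 = 1)//; exact: val_inj.
        + by rewrite (_ : Ordinal k3 = 2%:R)//; exact: val_inj.
      rewrite /= lee_fin ger0_norm ?invr_ge0 ?exprn_even_ge0//.
      move: xd; rewrite -[_ + _ + _](dotp_point3_sqr (x0, x1, x2)) => /andP[xd0 xd].
      by rewrite lef_pV2 ?posrE ?exprn_gt0// ler_pXn2r ?nnegrE ?ltW// ltW.
  apply: (@le_trans _ _ ((d ^- 2)%:E * ((d / 2) * (2 * e) ^+ 2)%:E)%E).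
    rewrite -EFinM lee_fin le_eqVlt; apply/orP; left; apply/eqP; field.
    by rewrite gt_eqF.
  by apply: lee_wpmul2l => //; rewrite lee_fin ltW.
case: (hvolume A) bound => [r| |] bound //; last first.
  by have := bound d0; rewrite d00 lexx => /(_ isT).
(* For finite volume [r], this [d] would give [2 * e ^+ 2 <= r * d < e ^+ 2]. *)
pose d := Num.min d0 (e ^+ 2 / (`|r| + 1)).
have r1 : 0 < `|r| + 1 by rewrite ltr_pwDr.
have dpos : 0 < d by rewrite lt_min d00 divr_gt0// exprn_gt0.
have := bound d; rewrite dpos ge_min lexx => /(_ isT); rewrite lee_fin.
rewrite ler_pdivrMr//; have : d * (`|r| + 1) <= e ^+ 2.
  by rewrite -ler_pdivlMr// ge_min lexx orbT.
have e2 : 0 < e ^+ 2 by rewrite exprn_gt0.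
have := ler_norm r; clear -e2 dpos => ? ? ?; exfalso; nra.
Qed.

End Volume.

(** * Polyhedra of finite volume are bounded *)

Section Polyhedron.
Variable R : realType.

Lemma exists_eps_forall (I : finType) (Q : I -> R -> Prop) :
  (forall i, exists2 e, 0 < e & forall t, 0 < t <= e -> Q i t) ->
  exists2 e, 0 < e & forall t, 0 < t <= e -> forall i, Q i t.
Proof.
move=> H; have /choice[f /all_and2[f0 Qf]] : forall i, exists e,
    0 < e /\ forall t, 0 < t <= e -> Q i t.
  by move=> i; have [e] := H i; exists e.
exists (\big[Num.min/1]_i f i).
  by elim/big_ind: _ => // x y x0 y0; rewrite lt_min x0.
move=> t /andP[t0 tf] i; apply: Qf; rewrite t0 (le_trans tf)//.
exact: bigmin_le_cond.
Qed.

Variables (N : nat) (P : polyhedron R N).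
Local Notation a i := (normal P i).1.
Local Notation c i := (normal P i).2.

Definition in_halfspaces (x : 'rV[R]_3) := forall i, dotp (a i) x <= c i.
Definition strictly_in (x : 'rV[R]_3) := forall i, dotp (a i) x < c i.

Lemma bodyP x : body P x <-> dotp x x < 1 /\ in_halfspaces x.
Proof.
split=> [[Hx Px]|[Hx Px]]; split=> // i; by case: (Px i).
Qed.

Lemma strictly_in_nbhs z : strictly_in z -> exists2 rho, 0 < rho &
  forall x : 'rV[R]_3, (forall k, `|x ord0 k - z ord0 k| < rho) -> strictly_in x.
Proof.
move=> sz.
have [|e e0 He] := @exists_eps_forall 'I_N (fun i rho =>
    forall x : 'rV[R]_3, (forall k, `|x ord0 k - z ord0 k| < rho) -> dotp (a i) x < c i).
  move=> i; pose m := `|a i ord0 0| + `|a i ord0 1| + `|a i ord0 2%:R|.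
  have m0 : 0 <= m by rewrite !addr_ge0.
  exists ((c i - dotp (a i) z) / (m + 1)).
    by rewrite divr_gt0 ?subr_gt0// ltr_wpDl.
  move=> t /andP[t0]; rewrite ler_pdivlMr ?ltr_wpDl// => tm x xz.
  rewrite -(subrK z x) dotpDr -ltrBrDr.
  have : dotp (a i) (x - z) <= m * t.
    rewrite dotpE !mxE (le_trans (ler_norm _))//.
    rewrite (le_trans (ler_normD _ _))// [m * t]mulrDl lerD//; last first.
      by rewrite normrM ler_wpM2l// ltW.
    rewrite (le_trans (ler_normD _ _))// mulrDl lerD//;
      by rewrite normrM ler_wpM2l// ltW.
  nra.
by exists e => // x xz i; apply: (He e) => //; rewrite e0/=.
Qed.

(** A topological interior point stays in the body when pushed slightly along any outward normal,
    which leaves slack in each inequality. Spacelike normals have nonzero Euclidean part. *)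
Lemma strictly_in_interior : exists2 p, dotp p p < 1 & strictly_in p.
Proof.
rewrite /strictly_in; case: P => n nn [p pint] _ /=.
exists p; first by case: (interior_subset pint).
move=> i; have ai : 0 < dotp (n i).1 (n i).1.
  by have := nn i; rewrite /lorentz subr_gt0; apply: le_lt_trans; rewrite -expr2 sqr_ge0.
have pcont : (p + t *: (n i).1) @[t --> 0] --> p.
  suff : (p + t *: (n i).1) @[t --> 0] --> p + 0 *: (n i).1.
    by rewrite scale0r addr0.
  apply: cvgD; first exact: cvg_cst.
  by apply: cvgZr_tmp; exact: cvg_id.
have /nbhs_ballP[e /= e0 He] := pcont _ pint.
have /He[_ /(_ i)[_]] : ball 0 e (e / 2).
  by rewrite /ball/= sub0r normrN gtr0_norm ?divr_gt0//; lra.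
rewrite dotpDr dotpZr; apply: lt_le_trans; rewrite ltrDl.
by rewrite mulr_gt0// divr_gt0.
Qed.

(** A segment from a strictly interior point to a point outside the closed ball crosses the sphere
    before its end, where all inequalities are still strict. The last coordinate is made nonzero for
    the sake of [hvolume_cap_infty]. *)
Lemma strictly_in_sphere : ~ (forall y, in_halfspaces y -> dotp y y <= 1) ->
  exists q, [/\ strictly_in q, dotp q q = 1 & q ord0 2%:R != 0].
Proof.
move=> nb; have [y Py y1] : exists2 y, in_halfspaces y & 1 < dotp y y.
  apply: contrapT => h; apply: nb => y Py; rewrite leNgt; apply/negP => y1.
  by apply: h; exists y.
have [p p1 sp] := strictly_in_interior.
have [d dE] : exists d, d = y - p by exists (y - p).
(* The squared norm along the segment, minus 1; its root is the crossing point. *)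
pose f : {poly R} := dotp d d *: 'X^2 + (2 * dotp p d) *: 'X + (dotp p p - 1)%:P.
have fE t : f.[t] = dotp (p + t *: d) (p + t *: d) - 1.
  by rewrite !(hornerD, hornerZ, hornerXn, hornerX, hornerC) !dotpLin (dotpC d p); ring.
have [|t /andP[t0]] := @poly_ivt _ f 0 1 ler01.
  rewrite !fE scale0r addr0 scale1r dE subrKC subr_le0 subr_ge0.
  by rewrite !ltW.
rewrite le_eqVlt => /predU1P[->|t1] /rootP.
  by rewrite fE scale1r dE subrKC => /eqP; rewrite subr_eq0 gt_eqF.
rewrite fE => /eqP; rewrite subr_eq0 => /eqP; set q := p + _ => qq.
have sq : strictly_in q.
  move=> i; have -> : q = (1 - t) *: p + t *: y.
    by rewrite /q dE scalerBr scalerBl scale1r addrA addrAC.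
  by rewrite !dotpLin; have := sp i; have := Py i; nra.
clearbody q; have [q2|q2] := eqVneq (q ord0 2%:R) 0; last by exists q.
have [rho rho0 Hrho] := strictly_in_nbhs sq.
pose h := Num.min (rho / 8) (1 / 2).
have h0 : 0 < h by rewrite lt_min !divr_gt0.
have hrho : h <= rho / 8 by rewrite ge_min lexx.
have h1 : h <= 1 / 2 by rewrite ge_min lexx orbT.
have hh : 0 < 1 + h ^+ 2 by rewrite ltr_pwDl// sqr_ge0.
pose e3 : 'rV[R]_3 := delta_mx ord0 2%:R.
(* Rotate [q] slightly towards [e3] along the great circle, in its rational parametrisation, so that
   no trigonometry enters. *)
pose q' := (1 + h ^+ 2)^-1 *: ((1 - h ^+ 2) *: q + (2 * h) *: e3).
have e33 : dotp e3 e3 = 1 by rewrite dotpE !mxE /=; ring.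
have qe3 : dotp q e3 = 0 by rewrite dotpE !mxE /= q2; ring.
exists q'; split.
- apply: Hrho => k; rewrite !mxE /=.
  have qk : `|q ord0 k| <= 1.
    apply: sqr_le1; rewrite -qq /dotp (bigD1 k)//= -expr2 lerDl.
    by apply: sumr_ge0 => j _; rewrite -expr2 sqr_ge0.
  set u := q ord0 k in qk *; set w : R := (_ == _)%:R.
  have /andP[w0 w1] : 0 <= w <= 1 by rewrite /w ler0n lern1 leq_b1.
  have -> : (1 + h ^+ 2)^-1 * ((1 - h ^+ 2) * u + 2 * h * w) - u =
      (2 * (h * w) - 2 * (h ^+ 2 * u)) / (1 + h ^+ 2).
    by field; rewrite gt_eqF.
  rewrite normrM (gtr0_norm (x := _^-1)) ?invr_gt0// ltr_pdivrMr//.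
  have hw0 : 0 <= h * w by rewrite mulr_ge0// ltW.
  have hw1 : h * w <= h by rewrite ger_pMr.
  have h2 : h ^+ 2 <= h / 2 by rewrite expr2 ler_pM2l//; lra.
  have h20 := sqr_ge0 h.
  have hu : `|h ^+ 2 * u| <= h ^+ 2 by rewrite normrM ger0_norm// ler_piMr.
  have : rho <= rho * (1 + h ^+ 2) by rewrite ler_pMr// lerDl.
  apply: lt_le_trans; rewrite ltr_norml.
  by move: hu; rewrite ler_norml => /andP[hu1 hu2]; apply/andP; split; lra.
- by rewrite /q' !dotpLin (dotpC e3) qe3 e33 qq; field; rewrite gt_eqF.
- by rewrite !mxE /= q2 mulr0 add0r mulr1 mulf_neq0 ?invr_eq0 ?mulf_neq0 ?gt_eqF.
Qed.

(** Otherwise the body contains a full neighbourhood, within the ball, of a point of the absolute,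
    and such a cap has infinite volume. *)
Theorem finite_volume_bounded : (hvolume (body P) < +oo)%E ->
  forall y, in_halfspaces y -> dotp y y <= 1.
Proof.
move=> vol; apply: contrapT => /strictly_in_sphere[q [sq qq q2]].
have [rho rho0 Hrho] := strictly_in_nbhs sq.
move: vol; rewrite (@hvolume_cap_infty _ _ q rho)//.
- exact: measurable_point3_body.
- by move=> x [].
- by move=> x Hx /Hrho sx; apply/bodyP; split=> // i; rewrite ltW.
Qed.

End Polyhedron.

(** * Faces and edges at an ideal vertex *)

Section IdealVertex.
Variables (R : realType) (N : nat) (P : polyhedron R N).
Local Notation a i := (normal P i).1.
Local Notation c i := (normal P i).2.

(** Irredundancy gives a point [x] violating only inequality [i]. The segment to it from a strictly
    interior point meets plane [i] strictly inside the other half-spaces. *)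
Lemma facet_point i : exists f, [/\ dotp f f < 1, dotp (a i) f = c i &
  forall j, j != i -> dotp (a j) f < c j].
Proof.
have [p p1 sp] := strictly_in_interior P.
have [x [x1 xj xi]] : exists x, [/\ dotp x x < 1,
    forall j, j != i -> dotp (a j) x <= c j & c i < dotp (a i) x].
  move: sp; rewrite /strictly_in; case: P => n _ _ irr /= _.
  apply: contrapT => nx; apply: (irr i) => x [Hx xj]; split=> //.
  rewrite leNgt; apply/negP => xi; apply: nx; exists x; split=> // j ji.
  by have [] := xj j ji.
pose t := (c i - dotp (a i) p) / (dotp (a i) x - dotp (a i) p).
have spi := sp i.
have den : 0 < dotp (a i) x - dotp (a i) p by rewrite subr_gt0 (lt_trans spi).
have t0 : 0 < t by rewrite divr_gt0// subr_gt0.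
have t1 : t < 1 by rewrite ltr_pdivrMr// mul1r ltrD2r.
exists ((1 - t) *: p + t *: x); split.
- have := dotp_ge0 (p - x); rewrite !dotpLin (dotpC x p).
  have : 0 <= t * (1 - t) by rewrite mulr_ge0// ?ltW// subr_gt0.
  by nra.
- by rewrite !dotpLin /t; field; rewrite gt_eqF.
- move=> j ji; rewrite !dotpLin.
  by have := sp j; have := xj j ji; nra.
Qed.

Hypothesis bounded : forall y, in_halfspaces P y -> dotp y y <= 1.
Hypothesis right_angled :
  forall i j, Defs.adjacent P i j -> dihedral_angle P i j = pi / 2.
Variable v : 'rV[R]_3.
Hypotheses (Pv : in_halfspaces P v) (vv : dotp v v = 1).

Let active i := dotp (a i) v == c i.
(* For active faces the Lorentz product of the normals is the Euclidean
   product of these projections to the orthogonal of [v]. *)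
Let b i := a i - c i *: v.

Let bv i : active i -> dotp (b i) v = 0.
Proof. by move=> /eqP iv; rewrite !dotpLin vv iv mulr1 subrr. Qed.

Let lorentzE i j : active i -> active j ->
  lorentz (normal P i) (normal P j) = dotp (b i) (b j).
Proof.
by move=> /eqP iv /eqP jv; rewrite /lorentz !dotpLin (dotpC v) vv iv jv; ring.
Qed.

Let lorentz_gt0 i : 0 < lorentz (normal P i) (normal P i).
Proof. by case: P => n n0 /=. Qed.

Let b_neq0 i : active i -> b i != 0.
Proof.
move=> Ai; apply/eqP => bi; have := lorentz_gt0 i.
by rewrite lorentzE// bi dotp0r ltxx.
Qed.

(** In the section [dotp d v = -1] the inequality [dotp (b i) d <= c i] therefore means
    [dotp (a i) d <= 0]: the ray from [v] along [d] enters half-space [i]. *)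
Let bE i d : dotp d v = -1 -> dotp (b i) d = dotp (a i) d + c i.
Proof. by move=> dv; rewrite !dotpLin (dotpC v) dv; ring. Qed.

Let step d : (forall i, active i -> dotp (a i) d <= 0) ->
  exists2 e, 0 < e & forall t, 0 < t <= e -> in_halfspaces P (v + t *: d).
Proof.
move=> Ad; apply: exists_eps_forall => i.
have [Ai|nAi] := boolP (active i).
  exists 1 => // t /andP[t0 _]; rewrite !dotpLin (eqP Ai) gerDl.
  by rewrite pmulr_rle0// Ad.
have lti : dotp (a i) v < c i by rewrite lt_neqAle nAi Pv.
have m0 : 0 < `|dotp (a i) d| + 1 by rewrite ltr_wpDl.
exists ((c i - dotp (a i) v) / (`|dotp (a i) d| + 1)).
  by rewrite divr_gt0// subr_gt0.
move=> t /andP[t0]; rewrite ler_pdivlMr// !dotpLin.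
by have := ler_norm (dotp (a i) d); nra.
Qed.

Let step_body d : cusp_section v active b (fun i => c i) d ->
  exists2 e, 0 < e & forall t, 0 < t <= e -> body P (v + t *: d).
Proof.
move=> [dv sd]; have [i Ai|e e0 He] := @step d.
  by have := sd i Ai; rewrite bE// gerDr.
have m0 : 0 < dotp d d + 1 by rewrite ltr_wpDl// dotp_ge0.
(* The squared norm of [v + t *: d] is [1 - 2 * t + t ^+ 2 * dotp d d], below 1 for such [t]. *)
exists (Num.min e (dotp d d + 1)^-1); first by rewrite lt_min e0 invr_gt0.
move=> t /andP[t0]; rewrite le_min => /andP[te td].
apply/bodyP; split; last by apply: He; rewrite t0.
rewrite !dotpLin vv (dotpC v) dv.
move: td; rewrite -div1r ler_pdivlMr// => td.
have : t * (t * (dotp d d + 1)) <= t * 1 by rewrite ler_pM2l.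
have : 0 < t * t by rewrite mulr_gt0.
by lra.
Qed.

Let cusp_facet i : active i -> exists g, [/\ dotp g v = -1, dotp (b i) g = c i &
  forall j, active j -> j != i -> dotp (b j) g < c j].
Proof.
move=> /eqP Ai; have [f [f1 fi fj]] := facet_point i.
have s0 : 0 < 1 - dotp f v.
  by have := dotp_ge0 (f - v); rewrite !dotpLin (dotpC v) vv; lra.
(* The facet point projected from [v] to the section. *)
pose g := (1 - dotp f v)^-1 *: (f - v).
have gv : dotp g v = -1 by rewrite !dotpLin vv; field; rewrite gt_eqF.
exists g; split=> // [|j /eqP Aj ji].
  by rewrite bE// !dotpLin fi Ai subrr mulr0 add0r.
by rewrite bE// !dotpLin Aj gtrDr pmulr_rlt0 ?invr_gt0// subr_lt0 fj.
Qed.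

(** Otherwise one could move from [v] along a tangent of the sphere inside all half-spaces, and so
    leave the closed ball. *)
Let cusp_bounded e : e != 0 -> dotp e v = 0 ->
  exists2 j, active j & 0 < dotp (b j) e.
Proof.
move=> e0 ev; apply: contrapT => nj.
have [i Ai|t t0 Ht] := @step e.
  rewrite leNgt; apply/negP => ie; apply: nj; exists i => //.
  by rewrite !dotpLin (dotpC v) ev mulr0 subr0.
have := bounded (Ht t _); rewrite t0 lexx => /(_ isT).
rewrite !dotpLin vv (dotpC v) ev; have := dotp_gt0 e0.
have : 0 < t * t by rewrite mulr_gt0.
by nra.
Qed.

(** The ray from [v] through a corner starts along a common edge of two faces, so they are adjacent
    and their Lorentz product vanishes. *)
Let cusp_right_angle i j r : cusp_corner v active b (fun i => c i) i j r ->
  dotp (b i) (b j) = 0.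
Proof.
move=> [Ai Aj ij sr ir jr]; have [e e0 He] := step_body sr.
have rv : dotp r v = -1 by case: sr.
have r0 : r != 0 by apply/eqP => r0; move: rv; rewrite dotpC r0 dotp0r; lra.
have onface k t : active k -> dotp (b k) r = c k -> 0 < t <= e ->
    face P k (v + t *: r).
  move=> /eqP Ak kr te; split; first exact: He.
  split; first by case/bodyP: (He _ te).
  by move: kr; rewrite bE// !dotpLin Ak => kr; rewrite [dotp _ r](_ : _ = 0); lra.
have adj : Defs.adjacent P i j.
  split; first exact/eqP.
  exists (v + e *: r), (v + (e / 2) *: r); split.
  - move=> /addrI/eqP; rewrite -subr_eq0 -scalerBl scaler_eq0 (negbTE r0) orbF.
    by apply/negP; lra.
  - by split; apply: onface; rewrite // e0/=.
  - by split; apply: onface => //; apply/andP; split; lra.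
have ni := lorentz_gt0 i; have nj := lorentz_gt0 j.
have := right_angled adj; rewrite /dihedral_angle.
set x := _ / _ => /(congr1 cos); rewrite cos_pihalf acosK; last first.
  (* Inverting [acos] requires an argument in [[-1, 1]]: this is Cauchy-Schwarz for [b i] and
     [b j]. *)
  rewrite in_itv/= -ler_norml; apply: sqr_le1.
  rewrite exprMn sqrrN exprVn exprMn !sqr_sqrtr ?(ltW ni) ?(ltW nj)//.
  rewrite ler_pdivrMr ?mulr_gt0// mul1r !lorentzE// -subr_ge0 -dotp_cross_sqr.
  exact: dotp_ge0.
move/eqP; rewrite /x mulf_eq0 invr_eq0 mulf_eq0 !sqrtr_eq0.
rewrite !leNgt ni nj /= orbF oppr_eq0 => /eqP.
by rewrite lorentzE.
Qed.

Record edge_ray (r : 'rV[R]_3) : Prop := EdgeRay {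
  _ : r != 0;
  _ : exists2 t, 0 < t & body P (v + t *: r);
  _ : exists i j, [/\ dotp (a i) r = 0, dotp (a j) r = 0
                                 & cross (a i) (a j) != 0]
}.

Definition spans_face i (r r' : 'rV[R]_3) := dotp (a i) v = c i /\
  forall x, in_halfspaces P x -> dotp (a i) x = c i ->
  exists p q, [/\ 0 <= p, 0 <= q & x - v = p *: r + q *: r'].

Theorem ideal_vertex_rays : exists i j l k r1 r2 r3 r4,
  [/\ uniq [:: i; j; l; k],
      [/\ edge_ray r1, edge_ray r2, edge_ray r3 & edge_ray r4],
      [/\ spans_face i r1 r4, spans_face j r2 r1,
          spans_face l r3 r2 & spans_face k r4 r3]
    & r1 + r3 = r2 + r4].
Proof.
have v0 : v != 0.
  by apply/eqP => v0; move: vv; rewrite v0 dotp0r => /esym/eqP; rewrite oner_eq0.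
have [i [j [l [k [r1 [r2 [r3 [r4 [un [c1 c2 c3 c4] [s1 s2 s3 s4] rr]]]]]]]]] :=
  cusp_rectangle v0 bv b_neq0 cusp_facet cusp_bounded cusp_right_angle.
have edge m n r : cusp_corner v active b (fun i => c i) m n r -> edge_ray r.
  move=> cr; case: (cr) => Am An mn sr mr nr.
  have rv : dotp r v = -1 by case: sr.
  have ar k' : dotp (b k') r = c k' -> dotp (a k') r = 0.
    by rewrite bE// => ?; lra.
  split.
  - by apply/eqP => r0; move: rv; rewrite dotpC r0 dotp0r; lra.
  - by have [e e0 He] := step_body sr; exists e => //; apply: He; rewrite e0 lexx.
  - exists m, n; split; [exact: ar|exact: ar|].
    (* The Gram determinant of [a m] and [a n] is a sum of nonnegative terms, one of which is the
       positive product of the squared norms of [b m] and [b n]. *)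
    apply/eqP => mn0; have := dotp_cross_sqr (a m) (a n).
    rewrite mn0 dotp0r.
    have aE k' : active k' -> a k' = b k' + c k' *: v by rewrite subrK.
    have := dotp_gt0 (b_neq0 Am); have := dotp_gt0 (b_neq0 An).
    have := bv Am; have := bv An; have := cusp_right_angle cr.
    rewrite (aE m Am) (aE n An); move: (b m) (b n) => bm bn mnv nv mv n0 m0.
    rewrite !dotpLin !(dotpC v) mnv nv mv vv.
    have := mulr_gt0 m0 n0; have := mulr_ge0 (ltW m0) (sqr_ge0 (c n)).
    by have := mulr_ge0 (ltW n0) (sqr_ge0 (c m)); nra.
have span m r r' : active m -> cusp_side v active b (fun i => c i) m r r' ->
    spans_face m r r'.
  move=> Am sm; split; first exact/eqP.
  move=> x Px mx.
  have [->|xv] := eqVneq x v.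
    by exists 0, 0; rewrite subrr !scale0r addr0.
  (* Dividing by [s] puts [x - v] in the section; [s] is positive since [x] lies in the closed ball
     and differs from [v]. *)
  pose s := 1 - dotp x v.
  have s0 : 0 < s.
    have : x - v != 0 by rewrite subr_eq0.
    by move/dotp_gt0; have := bounded Px; rewrite /s !dotpLin (dotpC v) vv; lra.
  pose d := s^-1 *: (x - v).
  have dv : dotp d v = -1 by rewrite !dotpLin vv /s; field; rewrite gt_eqF.
  have [||p [q [p0 q0 _ dE]]] := sm d.
  - split=> // n /eqP An; rewrite bE// !dotpLin An gerDr.
    by rewrite pmulr_rle0 ?invr_gt0// subr_le0 Px.
  - by rewrite bE// !dotpLin mx (eqP Am) subrr mulr0 add0r.
  exists (s * p), (s * q); split; try exact: (mulr_ge0 (ltW s0)).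
  by rewrite -!scalerA -scalerDr -dE scalerA divff ?scale1r// gt_eqF.
exists i, j, l, k, r1, r2, r3, r4; split=> //.
  by split; [exact: edge c1|exact: edge c2|exact: edge c3|exact: edge c4].
by split; apply: span => //; [case: c1|case: c2|case: c3|case: c4].
Qed.

End IdealVertex.

(** * Counting highest and lowest vertices of faces *)

Section Topology.
Variable R : realType.

Lemma dotp_continuous (l : 'rV[R]_3) : continuous (fun x : 'rV[R]_3 => dotp l x).
Proof.
under eq_fun do rewrite dotpE.
have g k : continuous (fun y : 'rV[R]_3 => l ord0 k * y ord0 k).
  by move=> x; apply: continuousM; [exact: cst_continuous|exact: coord_continuous].
by move=> x; exact: continuousD (continuousD (g 0 x) (g 1 x)) (g 2%:R x).
Qed.

Lemma dotp_sqr_continuous : continuous (fun x : 'rV[R]_3 => dotp x x).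
Proof.
under eq_fun do rewrite dotpE.
have g k : continuous (fun y : 'rV[R]_3 => y ord0 k * y ord0 k).
  by move=> x; apply: continuousM; exact: coord_continuous.
by move=> x; exact: continuousD (continuousD (g 0 x) (g 1 x)) (g 2%:R x).
Qed.

Lemma closure_le (f : 'rV[R]_3 -> R) (m : R) (A : set 'rV[R]_3) :
  continuous f -> (forall x, A x -> f x <= m) ->
  forall x, closure A x -> f x <= m.
Proof.
move=> fc Am; have cl : closed [set x | f x <= m].
  exact: (preimage_closed (fun x _ => fc x) (@closed_le _ m)).
move=> x Ax; suff : [set y | f y <= m] x by [].
by rewrite ((closure_id _).1 cl); exact: closureS Ax.
Qed.

Variables (N : nat) (P : polyhedron R N).

Lemma closure_body_le1 x : closure (body P) x -> dotp x x <= 1.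
Proof.
by apply: (closure_le dotp_sqr_continuous) => y /bodyP[/ltW].
Qed.

Lemma closure_body_in_halfspaces x : closure (body P) x -> in_halfspaces P x.
Proof.
move=> Px i; apply: (closure_le (@dotp_continuous (normal P i).1)) Px => y.
by case/bodyP.
Qed.

Lemma compact_closure_body : compact (closure (body P)).
Proof.
apply: bounded_closed_compact; last exact: closed_closure.
exists 1; split; first exact: num_real.
move=> M M1 x /closure_body_le1 x1 /=.
rewrite /Num.norm /= mx_normrE; apply: bigmax_le => [|[i j] _ /=].
  by rewrite (le_trans _ (ltW M1)).
rewrite (le_trans _ (ltW M1))// ord1; apply: sqr_le1; apply: le_trans x1.
rewrite /dotp (bigD1 j)//= -expr2 lerDl.
by apply: sumr_ge0 => k _; rewrite -expr2 sqr_ge0.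
Qed.

(** Among the maximisers of [l] on the compact closure take one of greatest Euclidean norm; strict
    convexity of the norm squared makes it an extreme point. *)
Lemma exists_top_vertex (l : 'rV[R]_3) :
  exists2 v, vertex P v & forall x, body P x -> dotp l x <= dotp l v.
Proof.
have K0 : closure (body P) !=set0.
  have [p p1 sp] := strictly_in_interior P; exists p; apply: subset_closure.
  by apply/bodyP; split=> // i; exact: ltW.
have cK := compact_closure_body.
have [|w /set_mem Kw wmax] := compact_EVT_max K0 cK (f := fun x => dotp l x).
  by apply: continuous_subspaceT; exact: dotp_continuous.
pose M := closure (body P) `&` (fun x => dotp l x) @^-1` [set dotp l w].
have cM : compact M.
  apply: compact_closedI => //; apply: preimage_closed; last exact: closed_eq.
  by move=> x _; exact: dotp_continuous.
have [|||v /set_mem[Kv /= vw] vmax] := @compact_EVT_max _ _ (fun x => dotp x x) M.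
- by exists w.
- exact: cM.
- by apply: continuous_subspaceT; exact: dotp_sqr_continuous.
exists v; last by move=> x /subset_closure Kx; rewrite vw wmax ?inE.
split=> // x y t Kx Ky /andP[t0 t1] vE.
have lx : dotp l x <= dotp l w by rewrite wmax ?inE.
have ly : dotp l y <= dotp l w by rewrite wmax ?inE.
move: (vw); rewrite vE !dotpLin => lxy.
have lxw : dotp l x = dotp l w by apply/eqP; rewrite eq_le lx/=; nra.
have lyw : dotp l y = dotp l w by apply/eqP; rewrite eq_le ly/=; nra.
have xv := vmax x; have yv := vmax y.
have {}xv : dotp x x <= dotp v v by apply: xv; rewrite inE.
have {}yv : dotp y y <= dotp v v by apply: yv; rewrite inE.
apply/eqP; rewrite -subr_eq0; apply/eqP/dotp_eq0/eqP.
rewrite eq_le dotp_ge0 andbT.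
move: xv yv; rewrite vE !dotpLin (dotpC y x) => xv yv.
(* This is [t * (1 - t)] times the squared distance from [x] to [y]. *)
have : t * (1 - t) * (dotp x x - dotp x y - (dotp x y - dotp y y)) <= 0 by nra.
rewrite pmulr_rle0 ?mulr_gt0 ?subr_gt0// => h; lra.
Qed.

End Topology.

(** * Generic functionals and the number of peaks at a vertex *)

Section Counting.
Variable R : realType.

Lemma exists_not_root (p : {poly R}) : p != 0 -> exists t, ~~ root p t.
Proof.
move=> p0; apply: contrapT => np.
have := @max_poly_roots _ p [seq n%:R | n <- iota 0 (size p)] p0.
rewrite size_map size_iota ltnn => H; apply: notF; apply: H.
  by apply/allP => x _; apply/negPn/negP => nx; apply: np; exists x.
by rewrite map_inj_uniq ?iota_uniq//; exact: mulrIn (oner_neq0 _).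
Qed.

(** On the moment curve [(1, t, t ^+ 2)] each [dotp l w] is a nonzero polynomial in [t]; take [t]
    off the roots of their product. *)
Lemma exists_generic (s : seq 'rV[R]_3) : all (fun w => w != 0) s ->
  exists l, forall w, w \in s -> dotp l w != 0.
Proof.
move=> /allP s0.
pose f (w : 'rV[R]_3) : {poly R} := \poly_(k < 3) w ord0 (inord k).
have [|t] := @exists_not_root (\prod_(w <- s) f w).
  rewrite prodf_seq_neq0; apply/allP => w /s0 /= w0; apply: contra w0 => /eqP fw0.
  apply/eqP/rowP => k; rewrite mxE -[k]inord_val.
  by have := congr1 (fun p : {poly R} => p`_k) fw0; rewrite coef_poly coef0 ltn_ord.
rewrite /root horner_prod prodf_seq_neq0 => /allP ft.
exists (\row_k t ^+ k) => w /ft; rewrite /= horner_poly; apply: contra.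
move=> /eqP lw; apply/eqP; rewrite -[RHS]lw /dotp; apply: eq_bigr => k _.
by rewrite mxE inord_val mulrC.
Qed.

Lemma sum_card_disjoint (T : eqType) (I : finType) (D : T -> {set I}) (s : seq T) :
  uniq s ->
  (forall v w i, v \in s -> w \in s -> i \in D v -> i \in D w -> v = w) ->
  (\sum_(v <- s) #|D v| <= #|I|)%N.
Proof.
move=> us disj.
under eq_bigr do rewrite -sum1_card big_mkcond.
rewrite exchange_big -sum1_card; apply: leq_sum => i _.
rewrite -big_mkcond sum1_count.
have [/hasP[v vs iv]|] := boolP (has (fun v => i \in D v) s); last first.
  by rewrite has_count -leqNgt leqn0 => /eqP ->.
rewrite (@eq_in_count _ _ (pred1 v)) ?count_uniq_mem ?leq_b1// => w ws /=.
by apply/idP/eqP => [iw|->//]; exact: disj iw iv.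
Qed.

Variables (N : nat) (P : polyhedron R N).
Local Notation a i := (normal P i).1.
Local Notation c i := (normal P i).2.

Definition face_max (l : 'rV[R]_3) i v := dotp (a i) v = c i /\
  forall x, in_halfspaces P x -> dotp (a i) x = c i -> x <> v ->
  dotp l x < dotp l v.

Lemma face_max_inj l i v w : in_halfspaces P v -> in_halfspaces P w ->
  face_max l i v -> face_max l i w -> v = w.
Proof.
move=> Pv Pw [iv vmax] [iw wmax]; apply: contrapT => vw.
have lt1 := wmax v Pv iv vw; have := vmax w Pw iw (nesym vw).
by rewrite ltNge ltW.
Qed.

Lemma spans_face_max l v i r r' : spans_face P v i r r' ->
  dotp l r < 0 -> dotp l r' < 0 -> face_max l i v.
Proof.
move=> [iv span] r0 r'0; split=> // x Px ix xv.
have [p [q [p0 q0 xE]]] := span x Px ix.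
rewrite -subr_lt0 -dotpNr -dotpDr xE !dotpLin.
have [p00|pn0] := eqVneq p 0; last first.
  have : 0 < p by rewrite lt_def pn0.
  by nra.
have [q00|qn0] := eqVneq q 0; last first.
  have : 0 < q by rewrite lt_def qn0.
  by nra.
by case: xv; apply/eqP; rewrite -subr_eq0 xE p00 q00 !scale0r addr0 eqxx.
Qed.

Definition signed (l : 'rV[R]_3) (s : bool) := if s then l else - l.

(** The boolean tells a highest point ([true]) of the face from a lowest one ([false]). *)
Definition peaks l v : {set 'I_N * bool} :=
  [set ip | `[< face_max (signed l ip.2) ip.1 v >]]%SET.

Lemma card_peaks_sum l (s : seq 'rV[R]_3) :
  uniq s -> (forall v, v \in s -> in_halfspaces P v) ->
  (\sum_(v <- s) #|peaks l v| <= 2 * N)%N.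
Proof.
move=> us Ps; apply: leq_trans (sum_card_disjoint us _) _.
  move=> v w ip vs ws; rewrite !inE => mv mw.
  exact: face_max_inj (Ps v vs) (Ps w ws) mv mw.
by rewrite card_prod card_ord card_bool mulnC.
Qed.

(** Edges run along cross products of face normals, so such an [l] is constant on no edge. *)
Definition generic l := forall i j,
  cross (a i) (a j) != 0 -> dotp l (cross (a i) (a j)) != 0.

Lemma exists_generic_normals : exists l, generic l.
Proof.
pose s := [seq w <- [seq cross (a ij.1) (a ij.2) | ij : 'I_N * 'I_N] | w != 0].
have [|l sl] := @exists_generic s; first exact: filter_all.
exists l => i j ij; apply: sl; rewrite mem_filter ij /=.
by apply/mapP; exists (i, j); rewrite ?mem_enum.
Qed.

Hypothesis ideal : ideal_right_angled P.

Lemma vertex_in_halfspaces v : vertex P v -> in_halfspaces P v.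
Proof. by move=> [Kv _]; exact: closure_body_in_halfspaces. Qed.

Lemma vertex_rays v : vertex P v -> exists i j l k r1 r2 r3 r4,
  [/\ uniq [:: i; j; l; k],
      [/\ edge_ray P v r1, edge_ray P v r2, edge_ray P v r3 & edge_ray P v r4],
      [/\ spans_face P v i r1 r4, spans_face P v j r2 r1,
          spans_face P v l r3 r2 & spans_face P v k r4 r3]
    & r1 + r3 = r2 + r4].
Proof.
case: ideal => vol abs ra vv; apply: ideal_vertex_rays => //.
- exact: finite_volume_bounded.
- exact: vertex_in_halfspaces.
- exact: abs.
Qed.

Lemma generic_edge_ray l v r : generic l -> edge_ray P v r -> dotp l r != 0.
Proof.
move=> gl [r0 _ [i [j [ir jr ij]]]]; apply: contra r0 => /eqP lr.
by apply/eqP; exact: cross_line_eq0 ij (gl i j ij) ir jr lr.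
Qed.

Lemma signed_face_max l s v i r r' : spans_face P v i r r' ->
  dotp (signed l s) r < 0 -> dotp (signed l s) r' < 0 -> (i, s) \in peaks l v.
Proof. by move=> sp r0 r'0; rewrite inE; apply/asboolP/(spans_face_max sp). Qed.

(** Two neighbouring rays on which [l] has the same sign make [v] a peak of the face they span.
    Around the cycle of four rays the sign changes evenly often, and four changes contradict
    [r1 + r3 = r2 + r4]; so two neighbouring pairs agree. *)
Lemma card_peaks_ge2 l v : generic l -> vertex P v -> (2 <= #|peaks l v|)%N.
Proof.
move=> gl /vertex_rays[i [j [m [k [r1 [r2 [r3 [r4 [un [e1 e2 e3 e4]]]]]]]]]].
move: e1 e2 e3 e4 => /(generic_edge_ray gl) n1 /(generic_edge_ray gl) n2.
move=> /(generic_edge_ray gl) n3 /(generic_edge_ray gl) n4 [s1 s2 s3 s4] rr.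
have := congr1 (dotp l) rr; rewrite !dotpDr => lrr.
have neg r : dotp l r != 0 -> dotp (signed l (dotp l r < 0)) r < 0.
  rewrite /signed; case: (ltgtP (dotp l r) 0) => //= r0 _.
  by rewrite dotpNl oppr_lt0.
have pk i' r r' : spans_face P v i' r r' -> (dotp l r < 0) = (dotp l r' < 0) ->
    dotp l r != 0 -> dotp l r' != 0 -> exists s, (i', s) \in peaks l v.
  move=> sp rr' rn0 rn0'; exists (dotp l r < 0).
  by apply: (signed_face_max sp); rewrite ?neg// rr' neg.
have two i1 i2 : i1 != i2 -> (exists s, (i1, s) \in peaks l v) ->
    (exists s, (i2, s) \in peaks l v) -> (1 < #|peaks l v|)%N.
  move=> i12 [b1 p1] [b2 p2]; apply/card_gt1P; exists (i1, b1), (i2, b2).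
  by split=> //; apply: contra i12 => /eqP[->].
move: un; rewrite /= !inE !negb_or !andbT -!andbA.
move=> /and5P[ij im ik jm /andP[jk mk]].
move: (pk _ _ _ s1) (pk _ _ _ s2) (pk _ _ _ s3) (pk _ _ _ s4).
(* Of the sixteen sign patterns only the two alternating ones reach the last, contradictory
   branch. *)
have [c1|c1] := ltP (dotp l r1) 0; have [c2|c2] := ltP (dotp l r2) 0;
have [c3|c3] := ltP (dotp l r3) 0; have [c4|c4] := ltP (dotp l r4) 0;
move=> pi pj pm pk';
first [ exact: two ij (pi erefl n1 n4) (pj erefl n2 n1)
      | exact: two im (pi erefl n1 n4) (pm erefl n3 n2)
      | exact: two ik (pi erefl n1 n4) (pk' erefl n4 n3)
      | exact: two jm (pj erefl n2 n1) (pm erefl n3 n2)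
      | exact: two jk (pj erefl n2 n1) (pk' erefl n4 n3)
      | exact: two mk (pm erefl n3 n2) (pk' erefl n4 n3)
      | by exfalso; clear -lrr c1 c2 c3 c4; lra ].
Qed.

Lemma edge_ray_top_lt0 l s v r : generic l ->
  (forall x, body P x -> dotp (signed l s) x <= dotp (signed l s) v) ->
  edge_ray P v r -> dotp (signed l s) r < 0.
Proof.
move=> gl top er; rewrite lt_neqAle; apply/andP; split.
  have := generic_edge_ray gl er.
  by rewrite /signed; case: s {top} => //; rewrite dotpNl oppr_eq0.
case: er => _ [t t0 /top]; rewrite dotpDr dotpZr gerDl.
by rewrite pmulr_rle0.
Qed.

(** All four edges descend from a top vertex, so it is the peak of all four faces around it. *)
Lemma card_peaks_top l s v : generic l -> vertex P v ->
  (forall x, body P x -> dotp (signed l s) x <= dotp (signed l s) v) ->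
  (4 <= #|peaks l v|)%N.
Proof.
move=> gl /vertex_rays[i [j [m [k [r1 [r2 [r3 [r4 [un [e1 e2 e3 e4]]]]]]]]]].
move=> [s1 s2 s3 s4] _ top; have neg := edge_ray_top_lt0 gl top.
have -> : 4%N = size [seq (i', s) | i' <- [:: i; j; m; k]] by [].
rewrite cardE; apply: uniq_leq_size.
  by rewrite map_inj_uniq// => ? ? [].
move=> ip /mapP[i' i'in ->]; rewrite mem_enum.
move: i'in; rewrite 4!in_cons in_nil orbF => /or4P[] /eqP->.
- exact: signed_face_max s1 (neg _ e1) (neg _ e4).
- exact: signed_face_max s2 (neg _ e2) (neg _ e1).
- exact: signed_face_max s3 (neg _ e3) (neg _ e2).
- exact: signed_face_max s4 (neg _ e4) (neg _ e3).
Qed.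

End Counting.

(** * Distinct vertices supplied by isolated triangles *)

Section Triangles.
Variables (R : realType) (N : nat) (P : polyhedron R N).

Lemma triangular_vertices i : triangular P i -> exists t : seq 'rV[R]_3,
  [/\ uniq t, size t = 3%N & forall v, v \in t -> face_vertices P i v].
Proof.
rewrite /triangular card_eq_sym => /pcard_eqP[f].
exists [seq f n | n <- iota 0 3]; split.
- rewrite map_inj_in_uniq ?iota_uniq// => m n m3 n3.
  by apply: (@inj _ _ _ f); rewrite inE/=; move: m3 n3; rewrite !mem_iota.
- by rewrite size_map size_iota.
- move=> v /mapP[n n3 ->]; apply: (@funS _ _ _ _ f).
  by move: n3; rewrite mem_iota => /andP[].
Qed.

Lemma disjoint_triangles_vertices : ITR_polyhedron P -> exists s : seq 'rV[R]_3,
  [/\ uniq s, size s = (3 * p3 P)%N & forall v, v \in s -> vertex P v].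
Proof.
move=> [_ itr].
rewrite /p3 cardE; set e := enum _.
(* For the induction each vertex remembers a triangle of the list; isolation then keeps the vertices
   of a new triangle apart from the earlier ones. *)
suff [s [us ss sv]] : exists s : seq 'rV[R]_3, [/\ uniq s,
    size s = (3 * size e)%N &
    forall v, v \in s -> exists2 i, i \in e & face_vertices P i v].
  by exists s; split=> // v /sv[i _ []].
have : uniq e by exact: enum_uniq.
have : forall i, i \in e -> triangular P i.
  by move=> i; rewrite mem_enum finset.inE => /asboolP.
elim: e => [|i e IH] /= tri; first by exists [::].
move=> /andP[ie ue]; have [|s [us ss sv]] := IH _ ue.
  by move=> j je; apply: tri; rewrite inE je orbT.
have [|t [ut st tv]] := @triangular_vertices i; first by apply: tri; rewrite inE eqxx.
exists (t ++ s); split.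
- rewrite cat_uniq ut us andbT /=; apply/hasPn => v /sv[j je jv]; apply/negP => vt.
  apply: (itr i j) => //; last by exists v; split => //; exact: tv.
  + by move=> ij; move: ie; rewrite ij je.
  + by apply: tri; rewrite inE eqxx.
  + by apply: tri; rewrite inE je orbT.
- by rewrite size_cat st ss mulnS.
- move=> v; rewrite mem_cat => /orP[/tv iv|/sv[j je jv]].
    by exists i; rewrite ?inE ?eqxx.
  by exists j; rewrite ?inE ?je ?orbT.
Qed.

End Triangles.

Theorem proposition4p1 (R : realType) (N : nat) (P : polyhedron R N)
    (hP : ideal_right_angled P) (hN : (N < 3 * p3 P + 2)%N) :
  ~ ITR_polyhedron P.
Proof.
move=> /disjoint_triangles_vertices[s [us ss sv]].
have [l gl] := exists_generic_normals P.
have [v Vv vmax] := exists_top_vertex P (signed l true).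
have [w Vw wmax] := exists_top_vertex P (signed l false).
(* On an edge at a vertex both highest and lowest, [l] would strictly decrease and strictly
   increase. *)
have vw : v != w.
  have [_ [_ [_ [_ [r [_ [_ [_ [_ [er _ _ _] _ _]]]]]]]]] := vertex_rays hP Vv.
  apply/eqP => vw; rewrite -vw in wmax.
  have := edge_ray_top_lt0 gl vmax er; have := edge_ray_top_lt0 gl wmax er.
  by rewrite /signed dotpNl oppr_lt0 => /lt_trans h /h; rewrite ltxx.
(* The top and bottom vertices need not belong to triangles; removing them from [s] costs at most
   two entries. *)
pose s' := [seq x <- s | ~~ ((x == v) || (x == w))].
have size_s' : (size s <= size s' + 2)%N.
  rewrite size_filter -(count_predC (predU (pred1 v) (pred1 w)) s) addnC leq_add2l.
  apply: (@leq_trans (count (pred1 v) s + count (pred1 w) s)).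
    by rewrite -count_predUI leq_addr.
  by rewrite !count_uniq_mem// (leq_add (leq_b1 _) (leq_b1 _)).
have := @card_peaks_sum _ _ P l [:: v, w & s'].
rewrite /= !big_cons filter_uniq// !inE (negbTE vw) !mem_filter !eqxx !orbT /=.
move=> /(_ isT) H.
have {H} sum_le : (#|peaks P l v| + (#|peaks P l w| +
    \sum_(x <- s') #|peaks P l x|) <= 2 * N)%N.
  apply: H => x; rewrite !inE => /or3P[/eqP->|/eqP->|].
  - exact: vertex_in_halfspaces.
  - exact: vertex_in_halfspaces.
  - by rewrite mem_filter => /andP[_ /sv]; exact: vertex_in_halfspaces.
have peaks_v := card_peaks_top hP gl Vv vmax.
have peaks_w := card_peaks_top hP gl Vw wmax.
have : (2 * size s' <= \sum_(x <- s') #|peaks P l x|)%N.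
  rewrite -sum1_size big_distrr /= !big_seq; apply: leq_sum => x.
  by rewrite mem_filter => /andP[_ /sv]; exact: card_peaks_ge2.
(* [2 * N] is at least [4 + 4 + 2 * (3 * p3 P - 2)], hence [N] is at least [3 * p3 P + 2]. *)
move: size_s' sum_le peaks_v peaks_w hN; rewrite ss; lia.
Qed.
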